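(* Suppose that $\mathcal{C}$ is the skeleton of $\mathcal{FI}$ spanned by the objects $[n]$ for all $n\in\mathbb{Z}_+$. Let $V$ be an $\mathcal{FI}$-module over $R$, and regard $V$ also as a $\mathcal{C}$-module by restriction along the inclusion functor $\mathcal{C}\to\mathcal{FI}$. Then $V$ is centrally stable as a $\mathcal{C}$-module over $R$ if and only if for all sufficiently large $N$ the canonical map $$\operatorname*{colim}_{S\subset[n],\ |S|\leqslant N}V(S)\longrightarrow V([n])$$ is an isomorphism for each $n\in\mathbb{Z}_+$.
   Context: $R$ is a commutative ring, $\mathbb{Z}_+$ is the set of non-negative integers, and $[n]=\{1,\ldots,n\}$. $\mathcal{FI}$ is the category of finite sets and injective maps. For a category $\mathcal{D}$, a $\mathcal{D}$-module over $R$ is a covariant functor from $\mathcal{D}$ to $R$-modules. The objects $[n]$ of $\mathcal{C}$ are identified with $n\in\mathbb{Z}_+$. The colimit is taken over the poset (under inclusion) of all subsets $S$ of $[n]$ with $|S|\leqslant N$, and the canonical map is induced by the maps $V(S)\to V([n])$ coming from the inclusions $S\hookrightarrow[n]$. A $\mathcal{C}$-module $V$ over $R$ is centrally stable if, for all sufficiently large $N$, $Ae\otimes_{eAe}eW\cong W$ as $A$-modules, where: $A=\bigoplus_{m,n\in\mathbb{Z}_+}R\operatorname{Hom}_{\mathcal{C}}(m,n)$ is the category algebra (free $R$-module on the morphisms of $\mathcal{C}$, product given by composition, zero when not composable); $e=e_0+e_1+\cdots+e_N$ with $e_n$ the identity morphism of $n$; and $W=\bigoplus_{n\in\mathbb{Z}_+}V(n)$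 with its natural $A$-module structure. *)

(* Defs.v *)
From HB Require Import structures.
From mathcomp Require Import all_boot all_order all_algebra.
From mathcomp Require Import boolp classical_sets cardinality fsbigop.

Set Implicit Arguments.
Unset Strict Implicit.
Unset Printing Implicit Defensive.

Import GRing.Theory.
Local Open Scope ring_scope.
Local Open Scope quotient_scope.

Section DirectSum.
Variables (R : pzRingType) (I : choiceType) (V : I -> lmodType R).
Implicit Types (i : I).

Definition fin_supp (v : forall i, V i) : Prop :=
  exists s : seq I, forall i, i \notin s -> v i = 0.

Record dsum := DSum { dcoef :> forall i, V i; _ : `[< fin_supp dcoef >] }.
HB.instance Definition _ := [isSub for dcoef].
HB.instance Definition _ := [Choice of dsum by <:].

Lemma dsumP (v : dsum) : fin_supp v.
Proof. by case: v => v /= /asboolP. Qed.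

Lemma dsum_ext (v w : dsum) : (forall i, v i = w i) -> v = w.
Proof. by move=> vw; apply/val_inj/functional_extensionality_dep. Qed.

Lemma fin_supp0 : fin_supp (fun i => 0).
Proof. by exists [::]. Qed.
Lemma fin_suppN (v : dsum) : fin_supp (fun i => - v i).
Proof. by case: (dsumP v) => s sv; exists s => i /sv ->; rewrite oppr0. Qed.
Lemma fin_suppD (v w : dsum) : fin_supp (fun i => v i + w i).
Proof.
case: (dsumP v) => s sv; case: (dsumP w) => t tw; exists (s ++ t) => i.
by rewrite mem_cat negb_or => /andP[/sv -> /tw ->]; rewrite addr0.
Qed.
Lemma fin_suppZ (r : R) (v : dsum) : fin_supp (fun i => r *: v i).
Proof. by case: (dsumP v) => s sv; exists s => i /sv ->; rewrite scaler0. Qed.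

Definition dzero : dsum := DSum (asboolT fin_supp0).
Definition dopp (v : dsum) : dsum := DSum (asboolT (fin_suppN v)).
Definition dadd (v w : dsum) : dsum := DSum (asboolT (fin_suppD v w)).
Definition dscale (r : R) (v : dsum) : dsum := DSum (asboolT (fin_suppZ r v)).

Fact daddA : associative dadd.
Proof. by move=> u v w; apply: dsum_ext => i /=; rewrite addrA. Qed.
Fact daddC : commutative dadd.
Proof. by move=> v w; apply: dsum_ext => i /=; rewrite addrC. Qed.
Fact dadd0 : left_id dzero dadd.
Proof. by move=> v; apply: dsum_ext => i /=; rewrite add0r. Qed.
Fact daddN : left_inverse dzero dopp dadd.
Proof. by move=> v; apply: dsum_ext => i /=; rewrite addNr. Qed.
HB.instance Definition _ := GRing.isZmodule.Build dsum daddA daddC dadd0 daddN.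

Fact dscaleA r s v : dscale r (dscale s v) = dscale (r * s) v.
Proof. by apply: dsum_ext => i /=; rewrite scalerA. Qed.
Fact dscale1 : left_id 1 dscale.
Proof. by move=> v; apply: dsum_ext => i /=; rewrite scale1r. Qed.
Fact dscaleDr : right_distributive dscale +%R.
Proof. by move=> r v w; apply: dsum_ext => i /=; rewrite scalerDr. Qed.
Fact dscaleDl v : {morph dscale^~ v : r s / r + s}.
Proof. by move=> r s; apply: dsum_ext => i /=; rewrite scalerDl. Qed.
HB.instance Definition _ :=
  GRing.Zmodule_isLmodule.Build R dsum dscaleA dscale1 dscaleDr dscaleDl.

#[local] Arguments dcoef : simpl never.

Lemma dcoef0 i : (0 : dsum) i = 0. Proof. by []. Qed.
Lemma dcoefD (v w : dsum) i : (v + w) i = v i + w i. Proof. by []. Qed.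
Lemma dcoefN (v : dsum) i : (- v) i = - v i. Proof. by []. Qed.
Lemma dcoefZ r (v : dsum) i : (r *: v) i = r *: v i. Proof. by []. Qed.

Lemma dcoef_sum (T : Type) (s : seq T) (F : T -> dsum) i :
  (\sum_(k <- s) F k) i = \sum_(k <- s) F k i.
Proof.
by elim: s => [|k s IH]; rewrite ?big_nil ?dcoef0 // !big_cons dcoefD IH.
Qed.

Definition din_fun i (x : V i) : forall j, V j :=
  dfwith (fun j => 0 : V j) x.

Lemma din_fun_supp i (x : V i) : fin_supp (din_fun x).
Proof.
exists [:: i] => j; rewrite inE => ji.
by rewrite /din_fun dfwith_out // eq_sym.
Qed.

Definition din i (x : V i) : dsum := DSum (asboolT (din_fun_supp x)).

Lemma din_in i (x : V i) : din x i = x.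
Proof. exact: dfwith_in. Qed.
Lemma din_out i j (x : V i) : j != i -> din x j = 0.
Proof. by move=> ji; apply: dfwith_out; rewrite eq_sym. Qed.

Fact din_is_linear i : linear (@din i).
Proof.
move=> r x y; apply: dsum_ext => j; rewrite dcoefD dcoefZ.
have [<-|ji] := eqVneq i j; first by rewrite !din_in.
by rewrite !din_out 1?eq_sym // scaler0 addr0.
Qed.
HB.instance Definition _ i := GRing.isLinear.Build R (V i) dsum *:%R (@din i)
  (@din_is_linear i).

Lemma dsum_decomp (v : dsum) (s : seq I) : uniq s ->
  (forall i, i \notin s -> v i = 0) -> v = \sum_(i <- s) din (v i).
Proof.
move=> us sv; apply: dsum_ext => i; rewrite dcoef_sum.
have [si|si] := boolP (i \in s).
  rewrite (bigD1_seq i si us) /= din_in big1 ?addr0 // => j ji.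
  by rewrite din_out // eq_sym.
rewrite sv // big_seq big1 // => j sj; rewrite din_out //.
by apply: contraNneq si => ->.
Qed.

Lemma dsum_ind (P : dsum -> Prop) : P 0 ->
  (forall i (x : V i) v, P v -> P (din x + v)) -> forall v, P v.
Proof.
move=> P0 PD v; case: (dsumP v) => s sv.
rewrite (@dsum_decomp v (undup s)) ?undup_uniq //; last first.
  by move=> i; rewrite mem_undup; apply: sv.
by elim: (undup s) => [|i t IH]; rewrite ?big_nil // big_cons; apply: PD.
Qed.

Section Lift.
Variable (M : lmodType R).

(* The map out of the direct sum given by linear maps on the summands;
   the sum is a finite one, over the support of i |-> f i (v i). *)
Definition dlift (f : forall i, {linear V i -> M}) (v : dsum) : M :=
  \sum_(i \in [set: I]) f i (v i).

Lemma dliftE f (v : dsum) (s : seq I) : uniq s ->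
  (forall i, i \notin s -> v i = 0) -> dlift f v = \sum_(i <- s) f i (v i).
Proof.
move=> us sv; rewrite /dlift (@fsbigE _ _ _ _ _ s) //; last first.
  by move=> i _ /sv ->; rewrite linear0.
by apply: eq_bigl => i; rewrite mem_set.
Qed.

Lemma dlift_common (v w : dsum) : exists s, [/\ uniq s,
  forall i, i \notin s -> v i = 0 & forall i, i \notin s -> w i = 0].
Proof.
case: (dsumP v) => s sv; case: (dsumP w) => t tw.
exists (undup (s ++ t)); split; first exact: undup_uniq.
- by move=> i; rewrite mem_undup mem_cat negb_or => /andP[/sv].
- by move=> i; rewrite mem_undup mem_cat negb_or => /andP[_ /tw].
Qed.

Fact dlift_is_linear f : linear (dlift f).
Proof.
move=> r v w; have [s [us sv sw]] := dlift_common v w.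
rewrite !(@dliftE f _ s) //; last first.
  by move=> i si; rewrite dcoefD dcoefZ sv // sw // scaler0 addr0.
by rewrite scaler_sumr -big_split; apply: eq_bigr => i _; rewrite /= linearP.
Qed.
HB.instance Definition _ f := GRing.isLinear.Build R dsum M *:%R (dlift f)
  (dlift_is_linear f).

Lemma dlift_din f i (x : V i) : dlift f (din x) = f i x.
Proof.
rewrite (@dliftE f _ [:: i]) //; last by move=> j; rewrite inE => /din_out ->.
by rewrite big_seq1 din_in.
Qed.

Lemma dlift_lin (r : R) (f g h : forall i, {linear V i -> M}) v :
  (forall i x, h i x = r *: f i x + g i x) ->
  dlift h v = r *: dlift f v + dlift g v.
Proof.
move=> hfg; have [s [us sv _]] := dlift_common v v.
rewrite !(@dliftE _ _ s) // scaler_sumr -big_split.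
by apply: eq_bigr => i _; rewrite hfg.
Qed.

End Lift.
End DirectSum.

Arguments din {R I V} i x.
Arguments dcoef {R I V} _ i : simpl never.

Section Free.
Variables (R : comPzRingType) (K : choiceType).

Definition free : lmodType R := dsum (fun _ : K => R^o).
Definition basis (k : K) : free := din (V := fun _ => R^o) k 1.

Lemma free_ind (P : free -> Prop) : P 0 ->
  (forall r k a, P a -> P (r *: basis k + a)) -> forall a, P a.
Proof.
move=> P0 PD; apply: dsum_ind => // k r a Pa.
suff -> : din k r = r *: basis k by apply: PD.
by rewrite -linearZ /= [r *: _]mulr1.
Qed.

Section Ext.
Variable M : lmodType R.

Definition scale_at (x : M) (r : R^o) : M := r *: x.
Fact scale_at_is_linear x : linear (scale_at x).
Proof. by move=> r s t; rewrite /scale_at scalerDl scalerA. Qed.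
HB.instance Definition _ x := GRing.isLinear.Build R R^o M *:%R (scale_at x)
  (scale_at_is_linear x).

(* The R-linear map sending basis k to f k. *)
Definition lext (f : K -> M) : {linear free -> M} :=
  dlift (fun k => scale_at (f k)).

Lemma lext_basis f k : lext f (basis k) = f k.
Proof. by rewrite /lext /= dlift_din /= /scale_at scale1r. Qed.

Lemma lext_lin (r : R) (f g h : K -> M) a :
  (forall k, h k = r *: f k + g k) -> lext h a = r *: lext f a + lext g a.
Proof.
move=> hfg; apply: dlift_lin => k x /=.
by rewrite /scale_at hfg scalerDr !scalerA mulrC.
Qed.

End Ext.
End Free.

Arguments basis {R K} k.

Section Quotient.
Variables (R : pzRingType) (M : lmodType R) (S : M -> Prop).

(* The submodule generated by S. *)
Inductive span : M -> Prop :=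
| span0 : span 0
| span_gen x : S x -> span x
| spanD x y : span x -> span y -> span (x + y)
| spanZ (r : R) x : span x -> span (r *: x).

Definition in_span : {pred M} := fun x => `[< span x >].

Fact in_span_closed : zmod_closed in_span.
Proof.
split=> [|x y /asboolP Sx /asboolP Sy]; first exact/asboolP/span0.
by apply/asboolP/spanD => //; rewrite -scaleN1r; apply: spanZ.
Qed.
HB.instance Definition _ := GRing.isZmodClosed.Build M in_span in_span_closed.

Definition quo : Type := Quotient.quot in_span.
HB.instance Definition _ := GRing.Zmodule.on quo.

Definition qpi (x : M) : quo := \pi_(Quotient.quot in_span) x.
Definition qrepr (x : quo) : M := repr (x : Quotient.quot in_span).

Lemma qreprK x : qpi (qrepr x) = x. Proof. exact: reprK. Qed.

Lemma qpi_eq x y : qpi x = qpi y <-> span (x - y).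
Proof.
split; first by move/eqP; rewrite -Quotient.idealrBE => /asboolP.
by move/asboolP => Sxy; apply/eqP; rewrite -Quotient.idealrBE.
Qed.

Lemma qpiD x y : qpi (x + y) = qpi x + qpi y.
Proof. exact: (raddfD (\pi_(Quotient.quot in_span))). Qed.

Definition qscale (r : R) (x : quo) : quo := qpi (r *: qrepr x).

Lemma qscale_pi r x : qscale r (qpi x) = qpi (r *: x).
Proof.
by apply/qpi_eq; rewrite -scalerBr; apply/spanZ/qpi_eq/qreprK.
Qed.

Fact qscaleA r s x : qscale r (qscale s x) = qscale (r * s) x.
Proof. by rewrite -[x]qreprK !qscale_pi scalerA. Qed.
Fact qscale1 : left_id 1 qscale.
Proof. by move=> x; rewrite -[x]qreprK qscale_pi scale1r. Qed.
Fact qscaleDr : right_distributive qscale +%R.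
Proof.
move=> r x y; rewrite -[x]qreprK -[y]qreprK -qpiD !qscale_pi.
by rewrite scalerDr qpiD.
Qed.
Fact qscaleDl x : {morph qscale^~ x : r s / r + s}.
Proof. by move=> r s; rewrite -[x]qreprK !qscale_pi scalerDl qpiD. Qed.
HB.instance Definition _ :=
  GRing.Zmodule_isLmodule.Build R quo qscaleA qscale1 qscaleDr qscaleDl.

Fact qpi_is_linear : linear qpi.
Proof. by move=> r x y; rewrite qpiD -qscale_pi. Qed.
HB.instance Definition _ := GRing.isLinear.Build R M quo *:%R qpi qpi_is_linear.

Lemma qpi_gen x : S x -> qpi x = 0.
Proof.
by move=> Sx; rewrite -(linear0 qpi); apply/qpi_eq; rewrite subr0; apply: span_gen.
Qed.

Section Lift.
Variables (M' : lmodType R) (f : {linear M -> M'}).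

(* The map induced on the quotient by a linear map killing the relations. *)
Definition qlift of (forall x, S x -> f x = 0) := fun x : quo => f (qrepr x).

Hypothesis fS : forall x, S x -> f x = 0.

Lemma qlift_pi x : qlift fS (qpi x) = f x.
Proof.
apply/subr0_eq; rewrite /qlift -linearB; have /qpi_eq := qreprK (qpi x).
elim=> [|y /fS //|y z _ fy _ fz|r y _ fy]; first by rewrite linear0.
- by rewrite linearD fy fz addr0.
- by rewrite linearZ_LR fy scaler0.
Qed.

Fact qlift_is_linear : linear (qlift fS).
Proof.
by move=> r x y; rewrite -[x]qreprK -[y]qreprK -linearP !qlift_pi linearP.
Qed.
HB.instance Definition _ := GRing.isLinear.Build R quo M' *:%R (qlift fS)
  qlift_is_linear.

End Lift.
End Quotient.

Arguments qpi {R M} S x.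

Section Image.
Variables (R : pzRingType) (M M' : lmodType R) (f : {linear M -> M'}).

Definition in_image : {pred M'} := fun y => `[< exists x, y = f x >].

Fact in_image_closed : submod_closed in_image.
Proof.
split=> [|r y z /asboolP[y' ->] /asboolP[z' ->]].
  by apply/asboolP; exists 0; rewrite linear0.
by apply/asboolP; exists (r *: y' + z'); rewrite linearP.
Qed.
HB.instance Definition _ :=
  GRing.isSubmodClosed.Build R M' in_image in_image_closed.

Record image := Image { image_val :> M'; _ : image_val \in in_image }.
HB.instance Definition _ := [isSub for image_val].
HB.instance Definition _ := [Choice of image by <:].
HB.instance Definition _ := [SubChoice_isSubLmodule of image by <:].

Lemma imageP (y : image) : exists x, image_val y = f x.
Proof. by case: y => y /= /asboolP. Qed.

Lemma in_imageP y : (exists x, y = f x) -> y \in in_image.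
Proof. by move=> fy; apply/asboolP. Qed.

Definition mk_image y (fy : exists x, y = f x) : image := Image (in_imageP fy).

End Image.

Section Algebras.
Variable R : comPzRingType.

(* The category algebra of a category with infinitely many objects has no
   unit, so algebras and their modules are not assumed unital here. *)
Record nualgebra := NUAlgebra {
  nucar :> lmodType R;
  numul : nucar -> nucar -> nucar;
  numul_linl : forall b, linear (numul^~ b);
  numul_linr : forall a, linear (numul a);
  numulA : associative numul }.

Record nulmodule (A : nualgebra) := NULmodule {
  lcar :> lmodType R;
  lact : A -> lcar -> lcar;
  lact_linl : forall w, linear (lact^~ w);
  lact_linr : forall a, linear (lact a);
  lactA : forall a b w, lact a (lact b w) = lact (numul a b) w }.

Record nubimodule (A B : nualgebra) := NUBimodule {
  bcar :> lmodType R;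
  blact : A -> bcar -> bcar;
  bract : bcar -> B -> bcar;
  blact_linl : forall m, linear (blact^~ m);
  blact_linr : forall a, linear (blact a);
  blactA : forall a a' m, blact a (blact a' m) = blact (numul a a') m;
  bract_linl : forall b, linear (bract^~ b);
  bract_linr : forall m, linear (bract m);
  bractA : forall m b b', bract (bract m b) b' = bract m (numul b b');
  blract : forall a m b, bract (blact a m) b = blact a (bract m b) }.

Definition lmod_isomorphic (A : nualgebra) (M N : nulmodule A) : Prop :=
  exists f : {linear M -> N},
    bijective f /\ forall a m, f (lact a m) = lact a (f m).

Section Tensor.
(* M (x)_B N as the free R-module on M x N modulo R-bilinearity and
   B-balancedness.  For B = eAe, which has the unit e acting as the identity on
   Ae and eW, B-balancedness already gives (r m) (x) n = m (x) (r n), so that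
   this is also the tensor product of abelian groups over B. *)
Variables (A B : nualgebra) (M : nubimodule A B) (N : nulmodule B).

Let F : lmodType R := free R (M * N)%type.

Inductive tensor_rel : F -> Prop :=
| tensor_linl (r : R) (m m' : M) (n : N) :
    tensor_rel (basis (r *: m + m', n) - (r *: basis (m, n) + basis (m', n)))
| tensor_linr (r : R) (m : M) (n n' : N) :
    tensor_rel (basis (m, r *: n + n') - (r *: basis (m, n) + basis (m, n')))
| tensor_bal (m : M) (b : B) (n : N) :
    tensor_rel (basis (bract m b, n) - basis (m, lact b n)).

Definition tensor_car : lmodType R := quo tensor_rel.
Definition tens (m : M) (n : N) : tensor_car := qpi tensor_rel (basis (m, n)).

Lemma tens_linl n : linear (tens^~ n).
Proof.
move=> r m m'; apply/subr0_eq; rewrite /tens -linearP -linearB.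
exact/qpi_gen/tensor_linl.
Qed.
Lemma tens_linr m : linear (tens m).
Proof.
move=> r n n'; apply/subr0_eq; rewrite /tens -linearP -linearB.
exact/qpi_gen/tensor_linr.
Qed.
Lemma tens_bal m b n : tens (bract m b) n = tens m (lact b n).
Proof.
by apply/subr0_eq; rewrite /tens -linearB; apply/qpi_gen/tensor_bal.
Qed.

(* The action of A on the tensor product, a (m (x) n) = (a m) (x) n. *)
Definition tact_free (a : A) : {linear F -> tensor_car} :=
  lext (fun p : M * N => tens (blact a p.1) p.2).

Fact tact_free_rel a x : tensor_rel x -> tact_free a x = 0.
Proof.
case=> [r m m' n|r m n n'|m b n]; rewrite linearB.
- rewrite [X in _ - X]linearP /tact_free !lext_basis /=.
  by rewrite blact_linr tens_linl subrr.
- rewrite [X in _ - X]linearP /tact_free !lext_basis /=.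
  by rewrite tens_linr subrr.
- by rewrite /tact_free !lext_basis /= -tens_bal blract subrr.
Qed.

Definition tact (a : A) : tensor_car -> tensor_car := qlift (@tact_free_rel a).

Lemma tact_tens a m n : tact a (tens m n) = tens (blact a m) n.
Proof. by rewrite /tact qlift_pi /tact_free lext_basis. Qed.

Lemma tensor_ind (P : tensor_car -> Prop) : P 0 ->
  (forall r m n x, P x -> P (r *: tens m n + x)) -> forall x, P x.
Proof.
move=> P0 PD x; rewrite -[x]qreprK; elim/free_ind: (qrepr x) => [|r [m n] a IH].
  by rewrite linear0.
by rewrite linearP; apply: PD.
Qed.

Fact tact_linl x : linear (tact^~ x).
Proof.
move=> r a a'; rewrite /tact /qlift; apply: lext_lin => -[m n] /=.
by rewrite blact_linl tens_linl.
Qed.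
Fact tact_linr a : linear (tact a).
Proof. exact: linearP. Qed.
Fact tactA a a' x : tact a (tact a' x) = tact (numul a a') x.
Proof.
elim/tensor_ind: x => [|r m n x IH]; first by rewrite /tact !linear0.
by rewrite !tact_linr IH !tact_tens blactA.
Qed.

Definition tensor : nulmodule A := NULmodule tact_linl tact_linr tactA.

End Tensor.

Section Corner.
Variables (A : nualgebra) (e : A).

Definition nlmul (a x : A) : A := numul a x.
HB.instance Definition _ a := GRing.isLinear.Build R A A *:%R (nlmul a)
  (numul_linr a).
Definition nrmul (b x : A) : A := numul x b.
HB.instance Definition _ b := GRing.isLinear.Build R A A *:%R (nrmul b)
  (numul_linl b).
Definition nlact (W : nulmodule A) (a : A) (w : W) : W := lact a w.
HB.instance Definition _ (W : nulmodule A) (a : A) := GRing.isLinear.Build R W W *:%R (@nlact W a)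
  (lact_linr a).

Definition eAe_car : lmodType R := image (nlmul e \o nrmul e).
Definition Ae_car : lmodType R := image (nrmul e).
Definition eW_car (W : nulmodule A) : lmodType R := image (@nlact W e).

Fact eAe_mul_subproof (x y : eAe_car) :
  exists z, numul (image_val x) (image_val y) = (nlmul e \o nrmul e) z.
Proof.
have [a ->] := imageP x; have [b ->] := imageP y.
exists (numul (numul a e) (numul e b)).
by rewrite /= /nlmul /nrmul !numulA.
Qed.
Definition eAe_mul x y : eAe_car := mk_image (eAe_mul_subproof x y).

Fact eAe_mul_linl y : linear (eAe_mul^~ y).
Proof. by move=> r x x'; apply/val_inj; rewrite /= numul_linl. Qed.
Fact eAe_mul_linr x : linear (eAe_mul x).
Proof. by move=> r y y'; apply/val_inj; rewrite /= numul_linr. Qed.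
Fact eAe_mulA : associative eAe_mul.
Proof. by move=> x y z; apply/val_inj; rewrite /= numulA. Qed.

Definition eAe : nualgebra := NUAlgebra eAe_mul_linl eAe_mul_linr eAe_mulA.

Fact Ae_lact_subproof (a : A) (x : Ae_car) :
  exists z, numul a (image_val x) = nrmul e z.
Proof. by have [b ->] := imageP x; exists (numul a b); rewrite /nrmul numulA. Qed.
Definition Ae_lact a x : Ae_car := mk_image (Ae_lact_subproof a x).

Fact Ae_ract_subproof (x : Ae_car) (y : eAe) :
  exists z, numul (image_val x) (image_val y) = nrmul e z.
Proof.
have [b ->] := imageP y; exists (numul (image_val x) (numul e b)).
by rewrite /= /nlmul /nrmul !numulA.
Qed.
Definition Ae_ract x y : Ae_car := mk_image (Ae_ract_subproof x y).

Fact Ae_lact_linl x : linear (Ae_lact^~ x).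
Proof. by move=> r a a'; apply/val_inj; rewrite /= numul_linl. Qed.
Fact Ae_lact_linr a : linear (Ae_lact a).
Proof. by move=> r x x'; apply/val_inj; rewrite /= numul_linr. Qed.
Fact Ae_lactA a a' x : Ae_lact a (Ae_lact a' x) = Ae_lact (numul a a') x.
Proof. by apply/val_inj; rewrite /= numulA. Qed.
Fact Ae_ract_linl y : linear (Ae_ract^~ y).
Proof. by move=> r x x'; apply/val_inj; rewrite /= numul_linl. Qed.
Fact Ae_ract_linr x : linear (Ae_ract x).
Proof. by move=> r y y'; apply/val_inj; rewrite /= numul_linr. Qed.
Fact Ae_ractA x y y' : Ae_ract (Ae_ract x y) y' = Ae_ract x (numul y y').
Proof. by apply/val_inj; rewrite /= numulA. Qed.
Fact Ae_lract a x y : Ae_ract (Ae_lact a x) y = Ae_lact a (Ae_ract x y).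
Proof. by apply/val_inj; rewrite /= numulA. Qed.

Definition Ae : nubimodule A eAe :=
  NUBimodule Ae_lact_linl Ae_lact_linr Ae_lactA
             Ae_ract_linl Ae_ract_linr Ae_ractA Ae_lract.

Section EW.
Variable W : nulmodule A.

Fact eW_act_subproof (x : eAe) (w : eW_car W) :
  exists w', lact (image_val x) (image_val w) = @nlact W e w'.
Proof.
have [a ->] := imageP x; exists (lact (nrmul e a) (image_val w)).
by rewrite /nlact lactA.
Qed.
Definition eW_act x w : eW_car W := mk_image (eW_act_subproof x w).

Fact eW_act_linl w : linear (eW_act^~ w).
Proof. by move=> r x x'; apply/val_inj; rewrite /= lact_linl. Qed.
Fact eW_act_linr x : linear (eW_act x).
Proof. by move=> r w w'; apply/val_inj; rewrite /= lact_linr. Qed.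
Fact eW_actA x y w : eW_act x (eW_act y w) = eW_act (numul x y) w.
Proof. by apply/val_inj; rewrite /= lactA. Qed.

Definition eW : nulmodule eAe := NULmodule eW_act_linl eW_act_linr eW_actA.

End EW.
End Corner.
End Algebras.

Record category (T : Type) := Category {
  hom : T -> T -> choiceType;
  cat_id : forall x, hom x x;
  cat_comp : forall x y z, hom y z -> hom x y -> hom x z;
  cat_compA : forall x y z t (h : hom z t) (g : hom y z) (f : hom x y),
    cat_comp h (cat_comp g f) = cat_comp (cat_comp h g) f;
  cat_comp1f : forall x y (f : hom x y), cat_comp (cat_id y) f = f;
  cat_compf1 : forall x y (f : hom x y), cat_comp f (cat_id x) = f }.

Arguments cat_id {T} c x.
Arguments cat_comp {T c x y z} g f.

Record functor (T U : Type) (C : category T) (D : category U) := Functor {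
  fob :> T -> U;
  fhom : forall x y, hom C x y -> hom D (fob x) (fob y);
  fhom_id : forall x, fhom (cat_id C x) = cat_id D (fob x);
  fhom_comp : forall x y z (g : hom C y z) (f : hom C x y),
    fhom (cat_comp g f) = cat_comp (fhom g) (fhom f) }.

Arguments fhom {T U C D} _ {x y} _.

Record cmodule (R : pzRingType) (T : Type) (C : category T) := CModule {
  mob :> T -> lmodType R;
  mhom : forall x y, hom C x y -> {linear mob x -> mob y};
  mhom_id : forall x v, mhom (cat_id C x) v = v;
  mhom_comp : forall x y z (g : hom C y z) (f : hom C x y) v,
    mhom (cat_comp g f) v = mhom g (mhom f v) }.

Arguments mhom {R T C} _ {x y} _.

Section Restrict.
Variables (R : pzRingType) (T U : Type) (C : category T) (D : category U).
Variables (F : functor C D) (V : cmodule R D).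

Fact restrict_id x v : mhom V (fhom F (cat_id C x)) v = v.
Proof. by rewrite fhom_id mhom_id. Qed.
Fact restrict_comp x y z (g : hom C y z) (f : hom C x y) v :
  mhom V (fhom F (cat_comp g f)) v = mhom V (fhom F g) (mhom V (fhom F f) v).
Proof. by rewrite fhom_comp mhom_comp. Qed.

Definition restrict : cmodule R C :=
  @CModule R T C (fun x => V (F x)) (fun x y f => mhom V (fhom F f))
    restrict_id restrict_comp.
End Restrict.

(* The category with objects T whose morphisms x -> y are those of D from j x
   to j y; for injective j, the full subcategory spanned by the j x. *)
Section FullSubcategory.
Variables (T U : Type) (D : category U) (j : T -> U).

Definition full_sub : category T :=
  @Category T (fun x y => hom D (j x) (j y)) (fun x => cat_id D (j x))
    (fun _ _ _ => cat_comp) (fun _ _ _ _ => @cat_compA _ D _ _ _ _)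
    (fun _ _ => @cat_comp1f _ D _ _) (fun _ _ => @cat_compf1 _ D _ _).

Definition full_incl : functor full_sub D :=
  @Functor T U full_sub D j (fun _ _ f => f) (fun=> erefl)
    (fun _ _ _ _ _ => erefl).
End FullSubcategory.

Section PreorderCategory.
Variables (T : Type) (le : rel T).
Hypotheses (le_refl : reflexive le) (le_trans : transitive le).

Definition le_hom (x y : T) : choiceType := {_ : unit | le x y}.
Definition le_arr x y (le_xy : le x y) : le_hom x y :=
  exist (fun=> is_true (le x y)) tt le_xy.

Lemma le_homP x y (f : le_hom x y) : le x y.
Proof. exact: (valP f). Qed.

Lemma le_hom_eq x y (f g : le_hom x y) : f = g.
Proof. by apply: val_inj; case: (val f) (val g) => [] []. Qed.

Definition preorder_cat : category T :=
  @Category T le_hom (fun x => le_arr (le_refl x))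
    (fun x y z g f => le_arr (le_trans (le_homP f) (le_homP g)))
    (fun _ _ _ _ _ _ _ => le_hom_eq _ _) (fun _ _ _ => le_hom_eq _ _)
    (fun _ _ _ => le_hom_eq _ _).
End PreorderCategory.

Section Colimit.
Variables (R : pzRingType) (T : choiceType) (C : category T) (V : cmodule R C).

Inductive colim_rel : dsum V -> Prop :=
| Colim_rel x y (f : hom C x y) (u : V x) :
    colim_rel (din y (mhom V f u) - din x u).

Definition colim : lmodType R := quo colim_rel.
Definition colim_in x (u : V x) : colim := qpi colim_rel (din x u).

Lemma colim_in_comp x y (f : hom C x y) u :
  colim_in (mhom V f u) = colim_in u.
Proof. by apply/subr0_eq; rewrite /colim_in -linearB; apply: qpi_gen. Qed.

Section Map.
Variables (M : lmodType R) (c : forall x, {linear V x -> M}).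

Definition cocone := forall x y (f : hom C x y) u, c y (mhom V f u) = c x u.

Fact colim_map_subproof : cocone -> forall v, colim_rel v -> dlift c v = 0.
Proof. by move=> cP v [x y f u]; rewrite linearB /= !dlift_din cP subrr. Qed.

(* The map out of the colimit induced by the cocone c. *)
Definition colim_map (cP : cocone) : {linear colim -> M} :=
  qlift (colim_map_subproof cP).

Lemma colim_map_in cP x (u : V x) : colim_map cP (colim_in u) = c x u.
Proof. exact: (etrans (qlift_pi _ _) (dlift_din _ _)). Qed.

End Map.
End Colimit.

Section CategoryAlgebra.
Variables (R : comPzRingType) (T : choiceType) (C : category T).

(* All morphisms, tagged by (source, target). *)
Definition mor : choiceType := {p : T * T & hom C p.1 p.2}.
Definition to_mor x y (f : hom C x y) : mor :=
  existT (fun p : T * T => hom C p.1 p.2) (x, y) f.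

(* g after f, or None if they are not composable. *)
Definition mor_comp (g f : mor) : option mor :=
  match (tag f).2 =P (tag g).1 with
  | ReflectT e =>
      Some (to_mor (cat_comp (tagged g) (ecast y (hom C (tag f).1 y) e (tagged f))))
  | ReflectF _ => None
  end.

Lemma mor_compE x y z (g : hom C y z) (f : hom C x y) :
  mor_comp (to_mor g) (to_mor f) = Some (to_mor (cat_comp g f)).
Proof.
by rewrite /mor_comp; case: eqP => //= e; rewrite (eq_irrelevance e erefl).
Qed.

Lemma mor_comp_none x y z t (g : hom C z t) (f : hom C x y) : y <> z ->
  mor_comp (to_mor g) (to_mor f) = None.
Proof. by move=> yz; rewrite /mor_comp; case: eqP. Qed.

Lemma morP (P : mor -> Prop) : (forall x y f, P (@to_mor x y f)) -> forall f, P f.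
Proof. by move=> toP [[x y] f]; apply: toP. Qed.

Let A : lmodType R := free R mor.

Definition calg_mul2 (g f : mor) : A := oapp basis 0 (mor_comp g f).
Definition calg_mul (a b : A) : A := lext (fun g => lext (calg_mul2 g) b) a.

Fact calg_mul_linl b : linear (calg_mul^~ b).
Proof. by move=> r a a'; rewrite /calg_mul linearP. Qed.
Fact calg_mul_linr a : linear (calg_mul a).
Proof. by move=> r b b'; apply: lext_lin => g; rewrite linearP. Qed.

Lemma calg_mul_basis g f :
  calg_mul (basis g) (basis f) = oapp basis 0 (mor_comp g f).
Proof. by rewrite /calg_mul !lext_basis. Qed.

Lemma calg_mul0l b : calg_mul 0 b = 0.
Proof. by rewrite /calg_mul linear0. Qed.
Lemma calg_mul0r a : calg_mul a 0 = 0.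
Proof. by have := calg_mul_linr a (- 1) 0 0; rewrite scaler0 addr0 scaleN1r addNr. Qed.

Lemma calg_mul_basisA h g f :
  calg_mul (basis h) (calg_mul (basis g) (basis f)) =
  calg_mul (calg_mul (basis h) (basis g)) (basis f).
Proof.
elim/morP: f => x y f; elim/morP: g => y' z g; elim/morP: h => z' t h.
rewrite !calg_mul_basis.
have [ey|/eqP ny] := eqVneq y y'; last first.
  rewrite (mor_comp_none _ _ ny) /= calg_mul0r.
  have [ez|/eqP nz] := eqVneq z z'.
    case: _ / ez h => h.
    by rewrite mor_compE /= calg_mul_basis (mor_comp_none _ _ ny).
  by rewrite (mor_comp_none _ _ nz) /= calg_mul0l.
case: _ / ey g => g; rewrite mor_compE /= calg_mul_basis.
have [ez|/eqP nz] := eqVneq z z'; last first.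
  by rewrite !(mor_comp_none _ _ nz) /= calg_mul0l.
by case: _ / ez h => h; rewrite !mor_compE /= calg_mul_basis mor_compE cat_compA.
Qed.

Fact calg_mulA : associative calg_mul.
Proof.
move=> a b c.
elim/free_ind: a => [|r h a IH]; first by rewrite !calg_mul0l.
rewrite !calg_mul_linl IH; congr (_ *: _ + _) => {IH}.
elim/free_ind: b => [|s g b IH]; first by rewrite !(calg_mul0l, calg_mul0r).
rewrite calg_mul_linl !calg_mul_linr calg_mul_linl IH.
congr (_ *: _ + _) => {IH}.
elim/free_ind: c => [|t f c IH]; first by rewrite !calg_mul0r.
by rewrite !calg_mul_linr IH calg_mul_basisA.
Qed.

Definition calg : nualgebra R := NUAlgebra calg_mul_linl calg_mul_linr calg_mulA.

Section Total.
Variable V : cmodule R C.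

(* A morphism f : x -> y acts on the direct sum of the V z by V f from the
   summand V x to the summand V y, and by 0 on the other summands. *)
Definition mor_act (f : mor) (w : dsum V) : dsum V :=
  din (tag f).2 (mhom V (tagged f) (w (tag f).1)).
Definition total_act (a : calg) (w : dsum V) : dsum V :=
  lext (fun f => mor_act f w) a.

Lemma mor_act_lin f : linear (mor_act f).
Proof. by move=> r w w'; rewrite /mor_act dcoefD dcoefZ !linearP. Qed.

Fact total_act_linl w : linear (total_act^~ w).
Proof. by move=> r a a'; rewrite /total_act linearP. Qed.
Fact total_act_linr a : linear (total_act a).
Proof. by move=> r w w'; apply: lext_lin => f; apply: mor_act_lin. Qed.

Lemma total_act_basis f w : total_act (basis f) w = mor_act f w.
Proof. by rewrite /total_act lext_basis. Qed.
Lemma total_act0l w : total_act 0 w = 0.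
Proof. by rewrite /total_act linear0. Qed.
Lemma total_act0r a : total_act a 0 = 0.
Proof. by have := total_act_linr a (- 1) 0 0; rewrite scaler0 addr0 scaleN1r addNr. Qed.

Lemma total_act_basisA g f w :
  total_act (basis g) (total_act (basis f) w) =
  total_act (calg_mul (basis g) (basis f)) w.
Proof.
elim/morP: f => x y f; elim/morP: g => y' z g.
rewrite !total_act_basis calg_mul_basis.
have [ey|/eqP ny] := eqVneq y y'; last first.
  rewrite (mor_comp_none _ _ ny) /= total_act0l /mor_act /=.
  by rewrite din_out ?linear0 //; apply/eqP => /esym.
case: _ / ey g => g; rewrite mor_compE /= total_act_basis /mor_act /=.
by rewrite din_in mhom_comp.
Qed.

Fact total_actA a b w : total_act a (total_act b w) = total_act (numul a b) w.
Proof.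
rewrite /=; elim/free_ind: a => [|r g a IH].
  by rewrite calg_mul0l !total_act0l.
rewrite calg_mul_linl !total_act_linl IH; congr (_ *: _ + _) => {IH}.
elim/free_ind: b => [|s f b IH].
  by rewrite calg_mul0r !total_act0l total_act0r.
by rewrite calg_mul_linr !total_act_linl total_act_linr IH total_act_basisA.
Qed.

Definition total : nulmodule calg :=
  NULmodule total_act_linl total_act_linr total_actA.

End Total.
End CategoryAlgebra.

Section CentralStability.
Variables (R : comPzRingType) (C : category nat).

Definition calg_e (N : nat) : calg R C :=
  \sum_(n < N.+1) basis (to_mor (cat_id C n)).

(* A e (x)_{eAe} e W and W are isomorphic as A-modules for all large N, where
   e = e_0 + ... + e_N; no particular isomorphism is required. *)
Definition centrally_stable (V : cmodule R C) : Prop :=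
  exists N0, forall N, (N0 <= N)%N ->
    lmod_isomorphic (tensor (Ae (calg_e N)) (eW (calg_e N) (total V))) (total V).

End CentralStability.

Section FiniteInjections.

Definition injection (S T : finType) : choiceType :=
  {f : {ffun S -> T} | injectiveb f}.

Fact to_injection_subproof (S T : finType) (f : S -> T) :
  injective f -> injectiveb (finfun f).
Proof. by move=> injf; apply/injectiveP => x y; rewrite !ffunE => /injf. Qed.

Definition to_injection (S T : finType) (f : S -> T) (injf : injective f) :
    injection S T :=
  exist (fun g : {ffun S -> T} => is_true (injectiveb g)) (finfun f)
    (to_injection_subproof injf).

Lemma injectionP (S T : finType) (f : injection S T) : injective (val f).
Proof. exact/injectiveP/(valP f). Qed.

Lemma injection_ext (S T : finType) (f g : injection S T) :
  (forall x, val f x = val g x) -> f = g.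
Proof. by move=> fg; apply/val_inj/ffunP. Qed.

Lemma to_injectionE (S T : finType) (f : S -> T) (injf : injective f) x :
  val (to_injection injf) x = f x.
Proof. exact: ffunE. Qed.

Definition injection_id (S : finType) : injection S S := to_injection (@inj_id S).

Definition injection_comp (S T U : finType) (g : injection T U)
    (f : injection S T) : injection S U :=
  to_injection (inj_comp (@injectionP _ _ g) (@injectionP _ _ f)).

Lemma injection_idE (S : finType) x : val (injection_id S) x = x.
Proof. exact: to_injectionE. Qed.
Lemma injection_compE (S T U : finType) (g : injection T U)
  (f : injection S T) x : val (injection_comp g f) x = val g (val f x).
Proof. exact: to_injectionE. Qed.

Fact injection_compA (S T U W : finType) (h : injection U W)
    (g : injection T U) (f : injection S T) :
  injection_comp h (injection_comp g f) = injection_comp (injection_comp h g) f.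
Proof. by apply: injection_ext => x; rewrite !injection_compE. Qed.
Fact injection_comp1f (S T : finType) (f : injection S T) :
  injection_comp (injection_id T) f = f.
Proof. by apply: injection_ext => x; rewrite injection_compE injection_idE. Qed.
Fact injection_compf1 (S T : finType) (f : injection S T) :
  injection_comp f (injection_id S) = f.
Proof. by apply: injection_ext => x; rewrite injection_compE injection_idE. Qed.

Definition FI : category finType :=
  Category injection_compA injection_comp1f injection_compf1.

(* The skeleton of FI on the sets [n], where 'I_n stands for [n]. *)
Definition FIskel : category nat := full_sub FI (fun n : nat => 'I_n : finType).
Definition FIskel_incl : functor FIskel FI := full_incl FI _.

End FiniteInjections.

Section SmallSubsets.
Variables (n N : nat).

Definition small_subset : choiceType := {S : {set 'I_n} | (#|S| <= N)%N}.
Definition subset_type (S : {set 'I_n}) : finType := {x : 'I_n | x \in S}.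

Definition small_le : rel small_subset := fun S T => val S \subset val T.
Fact small_le_refl : reflexive small_le. Proof. by move=> S; rewrite /small_le subxx. Qed.
Fact small_le_trans : transitive small_le.
Proof. by move=> T S U; apply: fintype.subset_trans. Qed.

(* The poset of the subsets S of [n] with |S| <= N. *)
Definition small_cat : category small_subset :=
  preorder_cat small_le_refl small_le_trans.

Definition sub_incl_fun (S T : {set 'I_n}) (ST : S \subset T)
    (x : subset_type S) : subset_type T :=
  exist (fun x => is_true (x \in T)) (val x) (fintype.subsetP ST _ (valP x)).
Fact sub_incl_inj (S T : {set 'I_n}) (ST : S \subset T) : injective (sub_incl_fun ST).
Proof. by move=> x y /(congr1 val) xy; apply: val_inj. Qed.
Definition sub_incl (S T : {set 'I_n}) (ST : S \subset T) :
    hom FI (subset_type S) (subset_type T) :=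
  to_injection (@sub_incl_inj _ _ ST).

Definition top_incl (S : {set 'I_n}) : hom FI (subset_type S) 'I_n :=
  to_injection (val_inj : injective (val : subset_type S -> 'I_n)).

Definition small_hom (S T : small_subset) (f : hom small_cat S T) :
    hom FI (subset_type (val S)) (subset_type (val T)) :=
  sub_incl (le_homP f).

Fact small_hom_id S : small_hom (cat_id small_cat S) = cat_id FI _.
Proof.
apply: injection_ext => x; rewrite injection_idE.
by apply: val_inj; rewrite to_injectionE.
Qed.
Fact small_hom_comp S T U (g : hom small_cat T U) (f : hom small_cat S T) :
  small_hom (cat_comp g f) = cat_comp (small_hom g) (small_hom f).
Proof.
apply: injection_ext => x; rewrite injection_compE.
by apply: val_inj; rewrite !to_injectionE.
Qed.

Definition small_functor : functor small_cat FI :=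
  @Functor _ _ small_cat FI (fun S => subset_type (val S)) small_hom
    small_hom_id small_hom_comp.

Lemma top_incl_comp (S T : small_subset) (f : hom small_cat S T) :
  cat_comp (top_incl (val T)) (small_hom f) = top_incl (val S).
Proof. by apply: injection_ext => x; rewrite injection_compE !to_injectionE. Qed.

Section Map.
Variables (R : comPzRingType) (V : cmodule R FI).

(* colim_{S \subset [n], |S| <= N} V(S) *)
Definition subset_colim : lmodType R := colim (restrict small_functor V).

Fact subset_cocone :
  @cocone R small_subset small_cat (restrict small_functor V) (V 'I_n)
    (fun S => mhom V (top_incl (val S))).
Proof. by move=> S T f u; rewrite -mhom_comp top_incl_comp. Qed.

Definition canonical_map : {linear subset_colim -> V 'I_n} :=
  colim_map subset_cocone.

End Map.
End SmallSubsets.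

(* Main.v *)
From HB Require Import structures.
Require Import Defs.
From mathcomp Require Import all_boot all_order all_algebra.
From mathcomp Require Import boolp.
Import Defs.

Set Implicit Arguments.
Unset Strict Implicit.
Unset Printing Implicit Defensive.

Import GRing.Theory.
Local Open Scope ring_scope.

(** Any isomorphism [phi : Ae (x)_{eAe} eW -> W] forces the multiplication map
    [a (x) w |-> a w] to be bijective, because an A-module isomorphic to an
    induced one is itself induced from its corner.  The multiplication map is
    then compared with the colimits: a subset [S] of [n] with k <= N elements is
    the image of an injection [f : [k] -> [n]], so sending [u] in [V(S)] to
    [f (x) f^-1 u] and [f (x) v] to the class of [f v] in [V(im f)] gives inverse
    isomorphisms between [(+)_n colim_{S \subset [n], |S| <= N} V(S)] and
    [Ae (x)_{eAe} eW], which turn multiplication into the sum of the canonical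
    maps. *)

(** * Bijections, and linear maps out of a balanced tensor product *)

Lemma inj_surj_bij (T U : Type) (f : T -> U) :
  injective f -> (forall y, exists x, f x = y) -> bijective f.
Proof.
move=> injf surjf; have [g gK] := choice surjf.
by exists g => // x; apply: injf; rewrite gK.
Qed.

Section TensorLift.
Variables (R : comPzRingType) (A B : nualgebra R).
Variables (M : nubimodule A B) (N : nulmodule B) (X : lmodType R).
Variable h : M -> N -> X.
Hypotheses (h_linl : forall n, linear (h^~ n)) (h_linr : forall m, linear (h m)).
Hypothesis h_bal : forall m b n, h (bract m b) n = h m (lact b n).

Fact tensor_lift_subproof x :
  tensor_rel x -> lext (fun p : M * N => h p.1 p.2) x = 0.
Proof.
case=> [r m m' n|r m n n'|m b n]; rewrite linearB.
- by rewrite [X in _ - X]linearP !lext_basis /= h_linl subrr.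
- by rewrite [X in _ - X]linearP !lext_basis /= h_linr subrr.
- by rewrite !lext_basis /= h_bal subrr.
Qed.

Definition tensor_lift : {linear tensor M N -> X} := qlift tensor_lift_subproof.

Lemma tensor_lift_tens m n : tensor_lift (tens m n) = h m n.
Proof. exact: (etrans (qlift_pi _ _) (lext_basis _ _)). Qed.

End TensorLift.

Lemma lact0 (R : comPzRingType) (A : nualgebra R) (W : nulmodule A) (a : A) :
  lact a (0 : W) = 0.
Proof. exact: (linear0 (nlact a)). Qed.

Lemma lactD (R : comPzRingType) (A : nualgebra R) (W : nulmodule A) (a : A) :
  {morph @lact R A W a : x y / x + y}.
Proof. exact: (linearD (nlact a)). Qed.

(** * Modules induced from the corner of an idempotent *)

Section CornerTensor.
Variables (R : comPzRingType) (A : nualgebra R) (e : A) (W : nulmodule A).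
Hypothesis eK : numul e e = e.
Implicit Types (a b : A) (w : W).

Local Notation T := (tensor (Ae e) (eW e W)).

(** Elements of [Ae], [eW] and [eAe] carry a proof of membership; writing them as ae, ew and eae for
    arbitrary a and w keeps these proofs out of the computations. *)
Definition Ae_of a : Ae e :=
  mk_image (ex_intro (fun z => nrmul e a = nrmul e z) a erefl).
Definition eW_of w : eW e W :=
  mk_image (ex_intro (fun z => @nlact R A W e w = nlact e z) w erefl).
Definition eAe_of a : eAe e :=
  mk_image
    (ex_intro (fun z => (nlmul e \o nrmul e) a = (nlmul e \o nrmul e) z) a erefl).

Lemma Ae_of_surj (m : Ae e) : exists a, m = Ae_of a.
Proof. by have [a ma] := imageP m; exists a; apply: val_inj. Qed.
Lemma eW_of_surj (n : eW e W) : exists w, n = eW_of w.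
Proof. by have [a ma] := imageP n; exists a; apply: val_inj. Qed.
Lemma eAe_of_surj (b : eAe e) : exists a, b = eAe_of a.
Proof. by have [a ma] := imageP b; exists a; apply: val_inj. Qed.

Lemma Ae_of_linear : linear Ae_of.
Proof. by move=> r a a'; apply/val_inj/numul_linl. Qed.
Lemma eW_of_linear : linear eW_of.
Proof. by move=> r w w'; apply/val_inj/lact_linr. Qed.

Definition ctens a w : T := tens (Ae_of a) (eW_of w).

Lemma ctens_linl w : linear (ctens^~ w).
Proof. by move=> r a a'; rewrite /ctens Ae_of_linear tens_linl. Qed.
Lemma ctens_linr a : linear (ctens a).
Proof. by move=> r w w'; rewrite /ctens eW_of_linear tens_linr. Qed.
HB.instance Definition _ a :=
  GRing.isLinear.Build R W T *:%R (ctens a) (ctens_linr a).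

Lemma ctens0l w : ctens 0 w = 0.
Proof. by have := ctens_linl w (- 1) 0 0; rewrite scaler0 addr0 scaleN1r addNr. Qed.

Lemma ctens_ind (P : T -> Prop) : P 0 ->
  (forall a w x, P x -> P (ctens a w + x)) -> forall x, P x.
Proof.
move=> P0 PD; apply: tensor_ind => // r m n x Px.
have [a ->] := Ae_of_surj m; have [w ->] := eW_of_surj n.
by rewrite -[tens _ _]/(ctens a w) -linearZ; apply: PD.
Qed.

Lemma lact_ctens a b w : lact (n := T) a (ctens b w) = ctens (numul a b) w.
Proof.
rewrite /ctens [LHS]tact_tens; congr tens.
by apply/val_inj; rewrite /= /nrmul numulA.
Qed.

Lemma ctens_mule a w : ctens (numul a e) w = ctens a w.
Proof.
by congr tens; apply/val_inj; rewrite /= /nrmul -numulA eK.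
Qed.

Lemma ctens_acte a w : ctens a (lact e w) = ctens a w.
Proof.
by congr tens; apply/val_inj; rewrite /= /nlact lactA eK.
Qed.

(** Balancedness over [eAe] at the element ebe: since e is idempotent, (ae)(ebe) = aebe and
    (ebe)(ew) = ebew. *)
Lemma ctens_bal a b w :
  ctens (numul (numul a e) b) w = ctens a (lact b (lact e w)).
Proof.
rewrite /ctens; have -> : Ae_of (numul (numul a e) b) = bract (Ae_of a) (eAe_of b).
  by apply/val_inj; rewrite /= /nrmul /nlmul !numulA -[numul (numul a e) e]numulA eK.
rewrite tens_bal; congr tens; apply/val_inj.
by rewrite /= /nrmul /nlmul /nlact !lactA -!numulA eK.
Qed.

Fact corner_mult_linl (n : eW e W) :
  linear (fun m : Ae e => lact (image_val m) (image_val n)).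
Proof. by move=> r m m'; rewrite lact_linl. Qed.
Fact corner_mult_linr (m : Ae e) :
  linear (fun n : eW e W => lact (image_val m) (image_val n)).
Proof. by move=> r n n'; rewrite lact_linr. Qed.
Fact corner_mult_bal (m : Ae e) (b : eAe e) (n : eW e W) :
  lact (image_val (bract m b)) (image_val n) =
  lact (image_val m) (image_val (lact b n)).
Proof. by rewrite /= lactA. Qed.

(** The counit at [W] of the adjunction between induction from [eAe] and the corner functor W |->
    eW. *)
Definition corner_mult : {linear T -> W} :=
  tensor_lift corner_mult_linl corner_mult_linr corner_mult_bal.

Lemma corner_mult_ctens a w : corner_mult (ctens a w) = lact a (lact e w).
Proof.
by rewrite /ctens tensor_lift_tens /= /nrmul /nlact !lactA -numulA eK.
Qed.

Lemma corner_mult_lact a x : corner_mult (lact a x) = lact a (corner_mult x).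
Proof.
elim/ctens_ind: x => [|b w x IH]; first by rewrite lact0 !linear0 lact0.
rewrite linearD !lactD linearD IH lact_ctens !corner_mult_ctens.
by rewrite !lactA.
Qed.

(** On generators, e(ae (x) ew) = eae (x) ew, and eae lies in [eAe], so it moves across the tensor
    to give e (x) eaew. *)
Lemma lact_corner x : lact e x = ctens e (corner_mult x).
Proof.
elim/ctens_ind: x => [|a w x IH]; first by rewrite lact0 !linear0.
rewrite lactD !linearD IH lact_ctens; congr (_ + _).
by rewrite corner_mult_ctens -[RHS]/(ctens e _) -ctens_bal eK.
Qed.

Section Endo.
Variable phi : {linear T -> W}.
Hypothesis phi_lact : forall a x, phi (lact a x) = lact a (phi x).

(* 1 (x) beta, where beta w = phi (e (x) w); composed with phi^-1 it gives a
   retraction of [corner_mult]. *)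
Definition corner_endo_fun (m : Ae e) (n : eW e W) : T :=
  tens m (eW_of (phi (tens (Ae_of e) n))).

Fact corner_endo_linl n : linear (corner_endo_fun^~ n).
Proof. by move=> r m m'; rewrite /corner_endo_fun tens_linl. Qed.
Fact corner_endo_linr m : linear (corner_endo_fun m).
Proof.
by move=> r n n'; rewrite /corner_endo_fun tens_linr linearP eW_of_linear tens_linr.
Qed.
(** The map beta is [eAe]-linear: e (x) bn = b(e (x) n), and b passes through [phi] by
    A-linearity. *)
Fact corner_endo_bal m (b : eAe e) n :
  corner_endo_fun (bract m b) n = corner_endo_fun m (lact b n).
Proof.
rewrite /corner_endo_fun.
have [a ->] := eAe_of_surj b; rewrite tens_bal; congr tens.
have -> : tens (Ae_of e) (lact (eAe_of a) n) =
    lact (n := T) (image_val (eAe_of a)) (tens (Ae_of e) n).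
  rewrite -tens_bal [RHS]tact_tens; congr tens; apply: val_inj.
  by rewrite /= /nlmul /nrmul !numulA eK -!numulA !eK numulA eK.
rewrite phi_lact; apply: val_inj.
by rewrite /= /nlact /nlmul /nrmul !lactA !numulA eK -!numulA eK.
Qed.

Definition corner_endo : {linear T -> T} :=
  tensor_lift corner_endo_linl corner_endo_linr corner_endo_bal.

Lemma corner_endo_ctens a w :
  corner_endo (ctens a w) = ctens a (phi (ctens e w)).
Proof. by rewrite /ctens tensor_lift_tens. Qed.

(** Let s be the inverse of [phi] and mu the multiplication map. Injectivity of mu follows from
    [corner_endo] o s o mu = id, surjectivity from mu o [corner_endo] = [phi]. *)
Lemma corner_mult_bij : bijective phi -> bijective corner_mult.
Proof.
case=> s phiK sK.
have s_lact a y : s (lact a y) = lact a (s y).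
  by apply: (can_inj phiK); rewrite phi_lact !sK.
have s_linear : linear s.
  by move=> r x y; apply: (can_inj phiK); rewrite sK linearP !sK.
pose s_isLinear := GRing.isLinear.Build R W T *:%R s s_linear.
pose sl : {linear W -> T} := HB.pack s s_isLinear.
have s0 : s 0 = 0 := linear0 sl.
have sD : {morph s : x y / x + y} := linearD sl.
have multK : cancel corner_mult (fun y => corner_endo (s y)).
  elim/ctens_ind => [|a w x IH]; first by rewrite linear0 s0 linear0.
  rewrite linearD sD linearD [X in _ + X]IH; congr (_ + _).
  (* Moving s past a and e turns aew into a(e (x) mu(s w)). After [corner_endo], the inner term is
     [phi] of e (x) mu(s w) = e s(w), which is ew. *)
  rewrite corner_mult_ctens s_lact s_lact lact_corner lact_ctens ctens_mule.
  by rewrite corner_endo_ctens -lact_corner phi_lact sK ctens_acte.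
apply: inj_surj_bij => [|y]; first exact: can_inj multK.
rewrite -[y]sK; elim/ctens_ind: (s y) => [|a w x [z zx]].
  by exists 0; rewrite !linear0.
(* The first summand is the value of [corner_endo] at [ctens a w]. *)
exists (ctens a (phi (ctens e w)) + z); rewrite !linearD zx; congr (_ + _).
by rewrite corner_mult_ctens -!phi_lact !lact_ctens eK ctens_mule.
Qed.

End Endo.

(** Replaces the unspecified isomorphism in central stability by one explicit map, which is A-linear
    and so is itself an isomorphism when bijective. *)
Lemma lmod_isomorphic_corner : lmod_isomorphic T W <-> bijective corner_mult.
Proof.
split=> [[phi [phi_bij phi_lact]]|mult_bij]; first exact: corner_mult_bij phi_bij.
by exists corner_mult; split=> //; apply: corner_mult_lact.
Qed.

End CornerTensor.

(** * The idempotent e_0 + ... + e_N and tensors of basis morphisms *)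

Section CategoryIdempotent.
Variables (R : comPzRingType) (C : category nat) (N : nat).

Local Notation e := (calg_e R C N).

Lemma calg_mul_basis_e x y (f : hom C x y) :
  numul (n := calg R C) (basis (to_mor f)) e =
  if (x <= N)%N then basis (to_mor f) else 0.
Proof.
rewrite /calg_e -/(nlmul _ _) linear_sum.
case: leqP => xN.
  rewrite (bigD1 (Ordinal (xN : (x < N.+1)%N))) //= /nlmul /= calg_mul_basis.
  rewrite mor_compE cat_compf1 big1 ?addr0 // => i ix.
  rewrite calg_mul_basis mor_comp_none // => E.
  by case/eqP: ix; apply: val_inj.
apply: big1 => i _; rewrite /nlmul /= calg_mul_basis mor_comp_none // => E.
by move: (ltn_ord i); rewrite E ltnS leqNgt xN.
Qed.

Lemma calg_e_idem : numul e e = e.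
Proof.
rewrite {1}/calg_e -/(nrmul e _) linear_sum; apply: eq_bigr => i _.
by have := calg_mul_basis_e (cat_id C i); rewrite -ltnS ltn_ord.
Qed.

Lemma total_act_e_din (V : cmodule R C) x (v : V x) :
  lact (n := total V) e (din x v) = if (x <= N)%N then din x v else 0.
Proof.
rewrite /= /total_act linear_sum; under eq_bigr do rewrite lext_basis /mor_act /= mhom_id.
case: leqP => xN.
  rewrite (bigD1 (Ordinal (xN : (x < N.+1)%N))) //= din_in big1 ?addr0 // => i ix.
  rewrite din_out ?linear0 //.
apply: big1 => i _; rewrite din_out ?linear0 //.
by apply: contraTneq xN => <-; rewrite -leqNgt -ltnS.
Qed.

Variable V : cmodule R C.

(** Since y <= N, f equals fe, so g can be moved across the tensor; since x <= N, e fixes the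
    summand [V x]. *)
Lemma ctens_din_comp x y z (f : hom C y z) (g : hom C x y) (v : V x) :
    (x <= N)%N -> (y <= N)%N ->
  ctens e (W := total V) (basis (to_mor (cat_comp f g))) (din x v) =
  ctens e (W := total V) (basis (to_mor f)) (din y (mhom V g v)).
Proof.
move=> xN yN.
have -> : basis (to_mor (cat_comp f g)) =
   numul (n := calg R C) (basis (to_mor f)) (basis (to_mor g)).
  by rewrite /= calg_mul_basis mor_compE.
have {1}-> : basis (to_mor f) = numul (n := calg R C) (basis (to_mor f)) e.
  by rewrite calg_mul_basis_e yN.
rewrite (ctens_bal calg_e_idem) total_act_e_din xN; congr ctens.
by rewrite /= total_act_basis /mor_act /= din_in.
Qed.

(** For x <= N, f = f e id_x, and moving id_x across the tensor projects [w] to its component at x;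
    for larger x, fe = 0. *)
Lemma ctens_basis x y (f : hom C x y) (w : total V) :
  ctens e (basis (to_mor f)) w =
  if (x <= N)%N then ctens e (W := total V) (basis (to_mor f)) (din x (dcoef w x))
  else 0.
Proof.
case: ifP => xN; last first.
  by rewrite -(ctens_mule calg_e_idem) calg_mul_basis_e xN ctens0l.
rewrite -[in LHS](cat_compf1 f).
have -> : basis (to_mor (cat_comp f (cat_id C x))) =
   numul (n := calg R C) (numul (n := calg R C) (basis (to_mor f)) e)
      (basis (to_mor (cat_id C x))).
  by rewrite calg_mul_basis_e xN /= calg_mul_basis mor_compE.
rewrite (ctens_bal calg_e_idem).
congr ctens; apply: etrans (lactA _ _ _) _.
rewrite [numul _ _]calg_mul_basis_e xN.
apply: etrans (total_act_basis _ _) _.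
by congr din; apply: mhom_id.
Qed.

End CategoryIdempotent.

(** * Colimits over small subsets *)

Lemma colim_ind (R : pzRingType) (I : choiceType) (C : category I)
    (V : cmodule R C) (P : colim V -> Prop) : P 0 ->
  (forall x (u : V x) c, P c -> P (colim_in u + c)) -> forall c, P c.
Proof.
move=> P0 PD c; rewrite -[c]qreprK.
elim/dsum_ind: (qrepr c) => [|x u v IH]; first by rewrite linear0.
by rewrite linearD; apply: PD.
Qed.

Section Comparison.
Variables (R : comPzRingType) (V : cmodule R FI) (N : nat).

Local Notation VC := (restrict FIskel_incl V).
Local Notation e := (calg_e R FIskel N).
Local Notation T := (tensor (Ae e) (eW e (total VC))).
Local Notation colims := (dsum (fun n => subset_colim n N V)).
Local Notation small_in S u :=
  (colim_in (V := restrict (small_functor _ N) V) (x := S) u).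

(** Since S' injects into [n], f' is f followed by the inclusion of S in S', and the colimit
    identifies elements along this inclusion. *)
Lemma small_in_eq n (D : finType) (S S' : small_subset n N)
    (f : hom FI D (subset_type (val S))) (f' : hom FI D (subset_type (val S'))) u :
  val S \subset val S' ->
  cat_comp (top_incl (val S)) f = cat_comp (top_incl (val S')) f' ->
  small_in S (mhom V f u) = small_in S' (mhom V f' u).
Proof.
move=> SS' ff'; rewrite -(colim_in_comp (le_arr SS' : hom (small_cat n N) S S')).
congr colim_in; rewrite /= -mhom_comp; congr (mhom V _ u).
apply: injection_ext => x; rewrite injection_compE; apply: val_inj.
have := congr1 (fun h : injection _ _ => val h x) ff'.
by rewrite !injection_compE !to_injectionE.
Qed.

(** * Injections [x] -> [y] and their classes in the colimit over subsets of [y] *)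

Section Corestriction.
Variables (x y : nat) (f : hom FI 'I_x 'I_y).

Definition im_set : {set 'I_y} := [set val f i | i : 'I_x].

Fact im_set_small : (x <= N)%N -> (#|im_set| <= N)%N.
Proof. by rewrite card_imset ?card_ord //; apply: injectionP. Qed.

Definition small_im (xN : (x <= N)%N) : small_subset y N :=
  exist (fun S : {set 'I_y} => is_true (#|S| <= N)%N) im_set (im_set_small xN).

Definition corestr_fun (i : 'I_x) : subset_type im_set :=
  exist (fun j => is_true (j \in im_set)) (val f i) (imset_f (val f) (erefl : i \in 'I_x)).

Fact corestr_inj : injective corestr_fun.
Proof. by move=> i j /(congr1 val) /injectionP. Qed.

Definition corestr : hom FI 'I_x (subset_type im_set) := to_injection corestr_inj.

Lemma top_incl_corestr : cat_comp (top_incl im_set) corestr = f.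
Proof. by apply: injection_ext => i; rewrite injection_compE !to_injectionE. Qed.

(** The counterpart of f (x) u on the colimit side. *)
Definition to_colim (xN : (x <= N)%N) (u : V 'I_x) : subset_colim y N V :=
  small_in (small_im xN) (mhom V corestr u).

Fact to_colim_linear xN : linear (to_colim xN).
Proof. by move=> r u v; rewrite /to_colim /colim_in !linearP. Qed.

End Corestriction.


(** The image of fg lies in the image of f, so both classes can be compared inside V(im f). *)
Lemma to_colim_comp x y z (f : hom FI 'I_y 'I_z) (g : hom FI 'I_x 'I_y)
    (xN : (x <= N)%N) (yN : (y <= N)%N) u :
  to_colim (cat_comp f g) xN u = to_colim f yN (mhom V g u).
Proof.
rewrite /to_colim -mhom_comp; apply: small_in_eq => /=.
  by apply/subsetP => _ /imsetP[i _ ->]; rewrite injection_compE imset_f.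
rewrite [LHS](@top_incl_corestr _ _ (cat_comp f g)).
by apply: injection_ext => i; rewrite !injection_compE !to_injectionE.
Qed.

(** * The map from the induced module to the colimits *)

(* Morphisms with a source larger than N are sent to 0, being killed by
   right multiplication with e. *)
Definition mor_colim (m : mor FIskel) (w : dsum VC) : colims :=
  match @idP ((tag m).1 <= N)%N with
  | ReflectT xN => din (tag m).2 (to_colim (tagged m) xN (w (tag m).1))
  | ReflectF _ => 0
  end.

Lemma mor_colimE x y (f : hom FIskel x y) w (xN : (x <= N)%N) :
  mor_colim (to_mor f) w = din y (to_colim (f : hom FI 'I_x 'I_y) xN (w x)).
Proof.
rewrite /mor_colim; case: {-}_ / idP => [xN'|//].
by rewrite (bool_irrelevance xN' xN).
Qed.


Lemma mor_colim_linear m : linear (mor_colim m).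
Proof.
elim/morP: m => x y f r w w'.
have [xN|/negbTE Nx] := boolP (x <= N)%N; last first.
  rewrite /mor_colim; case: {-}_ / idP => [|_]; first by move=> xN; have := etrans (esym Nx) xN.
  by rewrite scaler0 addr0.
rewrite !(mor_colimE _ _ xN) dcoefD dcoefZ -linearP; congr din.
exact: to_colim_linear.
Qed.

Definition calg_colim (a : calg R FIskel) (w : dsum VC) : colims :=
  lext (fun m => mor_colim m w) a.

Lemma calg_colim_linl w : linear (calg_colim^~ w).
Proof. by move=> r a a'; rewrite /calg_colim linearP. Qed.
Lemma calg_colim_linr a : linear (calg_colim a).
Proof. by move=> r w w'; apply: lext_lin => m; apply: mor_colim_linear. Qed.

Lemma calg_colim0l w : calg_colim 0 w = 0.
Proof. by rewrite /calg_colim linear0. Qed.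
Lemma calg_colim0r a : calg_colim a 0 = 0.
Proof.
by have := calg_colim_linr a (- 1) 0 0; rewrite scaler0 addr0 scaleN1r addNr.
Qed.
Lemma calg_colim_basis m w : calg_colim (basis m) w = mor_colim m w.
Proof. by rewrite /calg_colim lext_basis. Qed.

(* Only y <= N is assumed: a morphism x -> y is injective, so x <= N follows. *)
Lemma mor_colim_bal y z (f : hom FIskel y z) m w : (y <= N)%N ->
  calg_colim (calg_mul (basis (to_mor f)) (basis m)) w =
  mor_colim (to_mor f) (mor_act m w).
Proof.
move=> yN; elim/morP: m => x y' g; rewrite calg_mul_basis /mor_act /=.
have [ey|/eqP ny] := eqVneq y' y; last first.
  rewrite (mor_comp_none _ _ ny) calg_colim0l (mor_colimE _ _ yN).
  rewrite din_out; last by apply/eqP => /esym.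
  by rewrite /to_colim /colim_in !linear0.
case: _ / ey f yN => f yN; rewrite mor_compE /= calg_colim_basis.
have xN : (x <= N)%N.
  apply: leq_trans yN; rewrite -(card_ord x) -(card_ord y').
  exact: leq_card (@injectionP _ _ g).
by rewrite (mor_colimE _ _ xN) (mor_colimE _ _ yN) din_in (to_colim_comp _ _ xN yN).
Qed.

(** By linearity [a] and [b] may be taken to be single morphisms; right multiplication by e leaves
    only those f with source at most N, as [mor_colim_bal] requires. *)
Lemma calg_colim_bal (a b : calg R FIskel) (w : total VC) :
  calg_colim (numul (numul a e) b) w = calg_colim (numul a e) (lact b w).
Proof.
rewrite /=; elim/free_ind: a => [|r m a IH].
  by rewrite !(calg_mul0l, calg_colim0l).
rewrite !(calg_mul_linl, calg_colim_linl) IH; congr (_ *: _ + _) => {IH a r}.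
elim/morP: m => y z f; have /= -> := calg_mul_basis_e R N f.
case: ifP => yN; last by rewrite !(calg_mul0l, calg_colim0l).
rewrite calg_colim_basis; elim/free_ind: b => [|r m b IH].
  by rewrite calg_mul0r calg_colim0l total_act0l -calg_colim_basis calg_colim0r.
rewrite calg_mul_linr calg_colim_linl total_act_linl mor_colim_linear IH.
by rewrite total_act_basis (mor_colim_bal _ _ _ yN).
Qed.

Fact psi_linl (n : eW e (total VC)) :
  linear (fun m : Ae e => calg_colim (image_val m) (image_val n)).
Proof. by move=> r m m'; rewrite calg_colim_linl. Qed.
Fact psi_linr (m : Ae e) :
  linear (fun n : eW e (total VC) => calg_colim (image_val m) (image_val n)).
Proof. by move=> r n n'; rewrite calg_colim_linr. Qed.
Fact psi_bal (m : Ae e) (b : eAe e) (n : eW e (total VC)) :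
  calg_colim (image_val (bract m b)) (image_val n) =
  calg_colim (image_val m) (image_val (lact b n)).
Proof. by have [a ->] := Ae_of_surj m; apply: calg_colim_bal. Qed.

Definition tensor_to_colim : {linear T -> colims} :=
  tensor_lift psi_linl psi_linr psi_bal.

Lemma tensor_to_colim_ctens x y (f : hom FIskel x y) (v : V 'I_x)
    (xN : (x <= N)%N) :
  tensor_to_colim (ctens e (W := total VC) (basis (to_mor f)) (din x v)) =
  din y (to_colim (f : hom FI 'I_x 'I_y) xN v).
Proof.
rewrite /ctens tensor_lift_tens; have := calg_mul_basis_e R N f.
have := total_act_e_din N (V := VC) v; rewrite xN.
set w := din x v.
rewrite /= /nrmul /nlact /= => -> ->.
by rewrite calg_colim_basis (mor_colimE _ _ xN) din_in.
Qed.

(** * The map from the colimits to the induced module *)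

Section SubsetIso.
Variables (n : nat) (S : {set 'I_n}).

(** The category algebra only sees the objects [k], so V(S) is reached through an enumeration of
    S. *)
Definition enum_fun (i : 'I_#|S|) : subset_type S :=
  exist (fun x => is_true (x \in S)) (enum_val i) (enum_valP i).
Definition rank_fun (x : subset_type S) : 'I_#|S| :=
  enum_rank_in (valP x) (val x).

Lemma rank_funK : cancel rank_fun enum_fun.
Proof. by move=> x; apply: val_inj; apply/enum_rankK_in/valP. Qed.
Lemma enum_fun_inj : injective enum_fun.
Proof. by move=> i j /(congr1 val) /enum_val_inj. Qed.

Definition enum_hom : hom FI 'I_#|S| (subset_type S) := to_injection enum_fun_inj.
Definition rank_hom : hom FI (subset_type S) 'I_#|S| :=
  to_injection (can_inj rank_funK).

Lemma rank_homK : cat_comp enum_hom rank_hom = cat_id FI _.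
Proof.
apply: injection_ext => x.
by rewrite injection_compE injection_idE !to_injectionE rank_funK.
Qed.

Definition enum_top : hom FIskel #|S| n := cat_comp (top_incl S) enum_hom.

Definition subset_tensor : {linear V (subset_type S) -> T} :=
  ctens e (W := total VC) (basis (to_mor enum_top)) \o
    (din (V := fun k : nat => V 'I_k) #|S| \o mhom V rank_hom).

(** Independence of the enumeration: with f the enumeration of S, h = f(f^-1 h), and f^-1 h moves
    across the tensor because |S| <= N. *)
Lemma subset_tensorE x (h : hom FI 'I_x (subset_type S)) (u : V 'I_x) :
    (x <= N)%N -> (#|S| <= N)%N ->
  subset_tensor (mhom V h u) =
  ctens e (W := total VC)
    (basis (to_mor (cat_comp (top_incl S) h : hom FIskel x n))) (din x u).
Proof.
move=> xN SN; pose g : hom FIskel x #|S| := cat_comp rank_hom h.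
have -> : subset_tensor (mhom V h u) =
    ctens e (W := total VC) (basis (to_mor enum_top)) (din #|S| (mhom VC g u)).
  by congr ctens; congr din; rewrite -mhom_comp.
rewrite -(ctens_din_comp _ _ _ xN SN); congr ctens; congr (basis (to_mor _)).
apply: injection_ext => i.
by rewrite !injection_compE !to_injectionE rank_funK.
Qed.

End SubsetIso.

(** Both sides equal f (x) v, where f : [k] -> [n] enumerates S and v = f^-1 u; on the left, f is
    factored through S'. *)
Fact subset_tensor_cocone n :
  @cocone R _ _ (restrict (small_functor n N) V) T
    (fun S => subset_tensor (val S)).
Proof.
move=> S S' f u.
have {1}-> : u = mhom V (enum_hom (val S)) (mhom V (rank_hom (val S)) u).
  by rewrite -mhom_comp rank_homK mhom_id.
pose g : hom FI 'I_#|val S| (subset_type (val S')) :=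
  cat_comp (small_hom f) (enum_hom (val S)).
set v := mhom V (rank_hom (val S)) u.
have -> : mhom (restrict (small_functor n N) V) f (mhom V (enum_hom (val S)) v) =
    mhom V g v by rewrite [RHS]mhom_comp.
rewrite [LHS](subset_tensorE g v (valP S) (valP S')).
congr ctens; congr (basis (to_mor _)); apply: injection_ext => i.
by rewrite !injection_compE !to_injectionE.
Qed.

Definition colim_to_tensor : {linear colims -> T} :=
  dlift (fun n => colim_map (@subset_tensor_cocone n)).


Lemma colim_to_tensor_in n (S : small_subset n N) u :
  colim_to_tensor (din n (small_in S u)) = subset_tensor (val S) u.
Proof.
rewrite /colim_to_tensor; apply: etrans (dlift_din _ _) _.
exact: colim_map_in.
Qed.

Lemma colims_ind (P : colims -> Prop) : P 0 ->
  (forall n (S : small_subset n N) (u : V (subset_type (val S))) c,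
     P c -> P (din n (small_in S u) + c)) -> forall c, P c.
Proof.
move=> P0 PD; apply: dsum_ind => // n c v Pv.
elim/colim_ind: c => [|S u c IH]; first by rewrite linear0 add0r.
by rewrite linearD -addrA; apply: PD.
Qed.

(** The enumeration f of S has its image inside S, and f f^-1 is the identity of S, so the class of
    f(f^-1 u) is that of u. *)
Lemma colim_to_tensorK : cancel colim_to_tensor tensor_to_colim.
Proof.
elim/colims_ind => [|n S u c IH]; first by rewrite !linear0.
rewrite !linearD IH colim_to_tensor_in; congr (_ + _).
apply: etrans (tensor_to_colim_ctens (enum_top _) _ (valP S)) _; congr din.
(* The identity of S is inserted so that both sides come from one element of V(S), as [small_in_eq]
   requires. *)
rewrite /to_colim -mhom_comp -[u in RHS](mhom_id (c := V)).
apply: small_in_eq => /=.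
  apply/subsetP => _ /imsetP[i _ ->].
  by rewrite injection_compE !to_injectionE; apply: valP.
apply: injection_ext => i; rewrite !injection_compE injection_idE !to_injectionE /=.
by rewrite ffunE /= !ffunE rank_funK.
Qed.

(** By linearity it suffices to treat f (x) v with x <= N and v in V([x]); it returns as the
    composite of the corestriction of f with the inclusion of im f, tensored with v, and this
    composite is f. *)
Lemma tensor_to_colimK : cancel tensor_to_colim colim_to_tensor.
Proof.
elim/ctens_ind => [|a w x IH]; first by rewrite !linear0.
rewrite !linearD IH; congr (_ + _) => {IH x}.
elim/free_ind: a => [|r m a IH]; first by rewrite ctens0l !linear0.
rewrite ctens_linl linearP [LHS]linearP IH; congr (_ *: _ + _) => {IH a r}.
elim/morP: m => x y f; rewrite ctens_basis.
case: ifP => xN; last by rewrite !linear0.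
rewrite tensor_to_colim_ctens /to_colim colim_to_tensor_in.
rewrite (subset_tensorE _ _ xN (im_set_small f xN)); congr ctens.
by congr (basis (to_mor _)); apply: top_incl_corestr.
Qed.

(** * The sum of the canonical maps and the multiplication map *)

Definition canonical_sum : {linear colims -> total VC} :=
  dlift (fun n => din (V := fun k : nat => V 'I_k) n \o canonical_map n N V).

Lemma canonical_sum_din n c :
  canonical_sum (din n c) = din (V := fun k : nat => V 'I_k) n (canonical_map n N V c).
Proof. exact: dlift_din. Qed.

(** Multiplying out f (x) f^-1 u gives f f^-1 u, the image of u under the inclusion of S in [n]. *)
Lemma corner_mult_colim c :
  corner_mult e (total VC) (colim_to_tensor c) = canonical_sum c.
Proof.
elim/colims_ind: c => [|n S u c IH]; first by rewrite !linear0.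
rewrite !linearD IH colim_to_tensor_in; congr (_ + _).
rewrite canonical_sum_din [RHS](congr1 _ (colim_map_in _ _)).
rewrite [LHS](corner_mult_ctens (calg_e_idem _ _ _)) total_act_e_din (valP S).
apply: etrans (total_act_basis _ _) _; rewrite /mor_act /= din_in; congr din.
rewrite -mhom_comp; congr (mhom V _ u).
apply: injection_ext => i; rewrite !injection_compE !to_injectionE.
by rewrite -[RHS](congr1 val (rank_funK i)).
Qed.

Lemma canonical_sumE c n : dcoef (canonical_sum c) n = canonical_map n N V (dcoef c n).
Proof.
elim/dsum_ind: c => [|m c v IH]; first by rewrite linear0 !dcoef0 [RHS]linear0.
rewrite linearD !dcoefD linearD IH canonical_sum_din; congr (_ + _).
have [<-|mn] := eqVneq m n; first by rewrite !din_in.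
by rewrite !din_out ?linear0 // eq_sym.
Qed.

(** The sum respects the grading by n, so the n-th component of its inverse, restricted to V([n]),
    inverts the canonical map at n. *)
Lemma canonical_sum_bij :
  bijective canonical_sum <-> forall n, bijective (canonical_map n N V).
Proof.
split=> [[g canK gK] n|can_bij].
  exists (fun v => dcoef (g (din n v)) n) => [c|v].
    by rewrite -canonical_sum_din canK din_in.
  by rewrite -canonical_sumE gK din_in.
apply: inj_surj_bij => [c c' cc'|v].
  apply: dsum_ext => n; apply: (bij_inj (can_bij n)).
  by rewrite -!canonical_sumE cc'.
elim/dsum_ind: v => [|n v w [c <-]]; first by exists 0; rewrite linear0.
have [g canK gK] := can_bij n.
by exists (din n (g v) + c); rewrite linearD canonical_sum_din gK.
Qed.

(** Multiplication and [canonical_sum] differ by the two mutually inverse comparison maps. *)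
Lemma corner_mult_canonical :
  bijective (corner_mult e (total VC)) <->
  forall n, bijective (canonical_map n N V).
Proof.
rewrite -canonical_sum_bij.
have c2t_bij : bijective colim_to_tensor.
  by exists tensor_to_colim; [apply: colim_to_tensorK | apply: tensor_to_colimK].
have t2c_bij : bijective tensor_to_colim.
  by exists colim_to_tensor; [apply: tensor_to_colimK | apply: colim_to_tensorK].
split=> bij.
  by apply: (eq_bij (bij_comp bij c2t_bij)) => c; apply: corner_mult_colim.
apply: (eq_bij (bij_comp bij t2c_bij)) => x.
by rewrite [LHS]/= -corner_mult_colim tensor_to_colimK.
Qed.

End Comparison.

Theorem corollary2p6 (R : comPzRingType) (V : cmodule R FI) :
  centrally_stable (restrict FIskel_incl V) <->
  (exists N0 : nat, forall N : nat, (N0 <= N)%N ->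
     forall n : nat, bijective (canonical_map n N V)).
Proof.
(* The equivalence holds for each N separately, so the same bound [N0] serves in both directions. *)
have stableP N := lmod_isomorphic_corner (total (restrict FIskel_incl V))
  (calg_e_idem R FIskel N).
by split=> -[N0 N0P]; exists N0 => N /N0P;
  [move/stableP/corner_mult_canonical | move/corner_mult_canonical/stableP].
Qed.
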